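(* For every state $\rho$ on $\mathbb{C}^d$, the trace distance coherence $C_{\mathrm{tr}}(\rho)$ is the optimal value of the following semidefinite program in the $d\times d$ Hermitian matrix variables $P,N,\delta$: $$\text{minimize}\quad \mathrm{Tr}(P+N)$$ subject to $P-N=\rho-\delta$, $\ \mathrm{Tr}\,\delta=1$, $\ \delta$ is diagonal, and $P,N,\delta\ge 0$ (positive semidefinite).
   Context: A state is a positive semidefinite $d\times d$ complex matrix of trace $1$; an incoherent state is a state that is diagonal in the fixed standard basis, and $\mathcal{I}$ is the set of incoherent states. $\|X\|_1=\mathrm{Tr}\sqrt{X^\dagger X}$ is the trace norm. The trace distance coherence is $C_{\mathrm{tr}}(\rho):=\min_{\delta\in\mathcal{I}}\|\rho-\delta\|_1$. *)

(* Defs.v *)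
From mathcomp Require Import all_boot all_order all_algebra.
From mathcomp Require Import boolp classical_sets reals constructive_ereal ereal.
From mathcomp Require Import complex.

Set Implicit Arguments.
Unset Strict Implicit.
Unset Printing Implicit Defensive.

Import Order.TTheory GRing.Theory Num.Theory.
Local Open Scope classical_set_scope.
Local Open Scope ring_scope.
Local Open Scope sesquilinear_scope.

Section Matrices.
Variables (C : numClosedFieldType) (d : nat).
Implicit Type A : 'M[C]_d.

Definition psd A : Prop :=
  A \is hermsymmx /\ forall v : 'cV[C]_d, 0 <= (v ^t* *m A *m v) 0 0.

(* Square root by functional calculus on the spectral decomposition
   A = U^-1 diag(lambda) U with U unitary. It is meaningful for psd A only:
   sqrtC is then the nonnegative root of each eigenvalue lambda_i >= 0
   (see mxsqrt_psd and mxsqrt_sqr). *)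
Definition mxsqrt A : 'M[C]_d :=
  invmx (spectralmx A) *m diag_mx (map_mx sqrtC (spectral_diag A))
    *m spectralmx A.

Lemma psd_spectral A : psd A ->
  A = (spectralmx A) ^t* *m diag_mx (spectral_diag A) *m spectralmx A
  /\ forall i, 0 <= spectral_diag A 0 i.
Proof.
move=> [hA pA]; set U := spectralmx A.
have Uu : U \is unitarymx := spectral_unitarymx A.
have eA : A = U ^t* *m diag_mx (spectral_diag A) *m U.
  by rewrite -(invmx_unitary Uu); apply/orthomx_spectralP/hermitian_normalmx.
split=> // i; have := pA (U ^t* *m delta_mx i 0).
rewrite [X in _ *m X *m _]eA trmx_mul map_mxM trmxCK !mulmxA.
rewrite !(mulmxtVK _ Uu) trmx_delta map_delta_mx -rowE -colE.
by rewrite !mxE eqxx mulr1n.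
Qed.

Lemma mxsqrt_psd A : psd A -> psd (mxsqrt A).
Proof.
move=> /psd_spectral[_ ge0]; rewrite /mxsqrt.
rewrite (invmx_unitary (spectral_unitarymx A)).
set U := spectralmx A; set D := diag_mx _.
have hD : D ^t* = D.
  apply/matrixP => i j; rewrite !mxE eq_sym; case: eqVneq => [->|_].
    by rewrite !mulr1n geC0_conj // sqrtC_ge0.
  by rewrite !mulr0n conjC0.
split.
  apply/is_hermitianmxP; rewrite expr0 scale1r.
  by rewrite !trmx_mul !map_mxM trmxCK hD mulmxA.
move=> v; set w := U *m v.
have -> : v ^t* *m (U ^t* *m D *m U) *m v = w ^t* *m (D *m w).
  by rewrite /w trmx_mul map_mxM !mulmxA.
rewrite mxE sumr_ge0 // => i _; rewrite mul_diag_mx !mxE mulrCA.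
by rewrite mulr_ge0 ?sqrtC_ge0 // mulrC mul_conjC_ge0.
Qed.

Lemma mxsqrt_sqr A : psd A -> mxsqrt A *m mxsqrt A = A.
Proof.
move=> /psd_spectral[eA _]; rewrite [RHS]eA /mxsqrt.
rewrite -(invmx_unitary (spectral_unitarymx A)) !mulmxA.
rewrite (mulmxK (spectral_unit A)); congr (_ *m _).
rewrite -mulmxA mulmx_diag; congr (_ *m diag_mx _).
by apply/rowP => i; rewrite !mxE -expr2 sqrtCK.
Qed.

Definition is_state A : Prop := psd A /\ \tr A = 1.

Definition is_incoherent A : Prop := is_state A /\ is_diag_mx A.

End Matrices.

Section TraceDistanceCoherence.
Variables (R : realType) (d : nat).
Implicit Types rho delta X P N : 'M[R[i]]_d.

(* The trace is a nonnegative real number here; Re only casts it to R. *)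
Definition trace_norm X : R := complex.Re (\tr (mxsqrt (X ^t* *m X))).

Definition is_minimum (S : set R) (m : R) : Prop := S m /\ lbound S m.

Definition incoherent_distances rho : set R :=
  [set trace_norm (rho - delta) | delta in [set A | is_incoherent A]].

(* The value 0 is returned only when the set has no least element. *)
Definition trace_coherence rho : R :=
  xget 0 [set m | is_minimum (incoherent_distances rho) m].

Record sdp_feasible rho P N delta : Prop := SdpFeasible {
  sdp_eq : P - N = rho - delta;
  sdp_trace : \tr delta = 1;
  sdp_diag : is_diag_mx delta;
  sdp_P : psd P;
  sdp_N : psd N;
  sdp_delta : psd delta }.

Definition sdp_values rho : set (\bar R) :=
  [set x | exists P N delta, sdp_feasible rho P N delta
                             /\ x = (complex.Re (\tr (P + N)))%:E].

(* Infimum in \bar R, so +oo would mean infeasible and -oo unbounded. *)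
Definition sdp_value rho : \bar R := ereal_inf (sdp_values rho).

End TraceDistanceCoherence.

(* Main.v *)
Require Import Defs.
From mathcomp Require Import all_boot all_order all_algebra.
From mathcomp Require Import boolp classical_sets reals constructive_ereal ereal.
From mathcomp Require Import complex.
From mathcomp Require Import topology normedtype derive ring.

(** For Hermitian [X], [tr |X|] is the minimum of [tr (P + N)] over the psd pairs
    with [P - N = X]: it is attained at the positive and negative parts of [X],
    and in an eigenbasis of [X] one has
    [|lambda_i| = |P_ii - N_ii| <= P_ii + N_ii].  Taking [X = rho - delta] and
    minimising over [delta] gives the program.

    The same characterisation makes the trace norm subadditive, so
    [rho - diag p] has a trace norm that is 1-Lipschitz in [p] for the l1
    distance; the minimum over the compact simplex of the [p] is therefore
    attained. *)

Set Implicit Arguments.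
Unset Strict Implicit.
Import Order.TTheory GRing.Theory Num.Theory.
Import numFieldNormedType.Exports.
Local Open Scope classical_set_scope.
Local Open Scope ring_scope.
Local Open Scope sesquilinear_scope.

(** * Adjoints, Hermitian and positive semidefinite matrices *)

Lemma hermsymmxP (C : numClosedFieldType) d (A : 'M[C]_d) :
  (A \is hermsymmx) <-> A ^t* = A.
Proof.
split=> [/is_hermitianmxP|eA]; first by rewrite expr0 scale1r => <-.
by apply/is_hermitianmxP; rewrite expr0 scale1r eA.
Qed.

Lemma adjmxM (C : numClosedFieldType) m n p (A : 'M[C]_(m, n)) (B : 'M_(n, p)) :
  (A *m B) ^t* = B ^t* *m A ^t*.
Proof. by rewrite trmx_mul map_mxM. Qed.

Lemma adjmxD (C : numClosedFieldType) m n (A B : 'M[C]_(m, n)) :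
  (A + B) ^t* = A ^t* + B ^t*.
Proof. by rewrite linearD map_mxD. Qed.

Lemma adjmxB (C : numClosedFieldType) m n (A B : 'M[C]_(m, n)) :
  (A - B) ^t* = A ^t* - B ^t*.
Proof. by rewrite linearB map_mxB. Qed.

Lemma hermsymmxB (C : numClosedFieldType) d (A B : 'M[C]_d) :
  A \is hermsymmx -> B \is hermsymmx -> A - B \is hermsymmx.
Proof.
by move=> /hermsymmxP hA /hermsymmxP hB; apply/hermsymmxP; rewrite adjmxB hA hB.
Qed.

Lemma psdD (C : numClosedFieldType) d (A B : 'M[C]_d) :
  psd A -> psd B -> psd (A + B).
Proof.
move=> [/hermsymmxP hA pA] [/hermsymmxP hB pB]; split.
  by apply/hermsymmxP; rewrite adjmxD hA hB.
by move=> v; rewrite mulmxDr mulmxDl mxE addr_ge0.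
Qed.

Lemma psd_conjmx (C : numClosedFieldType) d (V A : 'M[C]_d) :
  psd A -> psd (V ^t* *m A *m V).
Proof.
move=> [/hermsymmxP hA pA]; split.
  by apply/hermsymmxP; rewrite !adjmxM trmxCK hA mulmxA.
by move=> v; have := pA (V *m v); rewrite adjmxM !mulmxA.
Qed.

Lemma hermsymmx_diag (C : numClosedFieldType) d (u : 'rV[C]_d) :
  (forall i, u 0 i \is Num.real) -> diag_mx u \is hermsymmx.
Proof.
move=> ru; apply/hermsymmxP/matrixP => i j; rewrite !mxE eq_sym.
by case: eqVneq => [->|_]; rewrite ?mulr0n ?conjC0 // !mulr1n conj_Creal.
Qed.

Lemma psd_diag_mx (C : numClosedFieldType) d (u : 'rV[C]_d) :
  (forall i, 0 <= u 0 i) -> psd (diag_mx u).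
Proof.
move=> u0; split; first by apply: hermsymmx_diag => i; rewrite ger0_real.
move=> v; rewrite -mulmxA mxE sumr_ge0 // => i _; rewrite mul_diag_mx !mxE mulrCA.
by rewrite mulr_ge0 // mulrC mul_conjC_ge0.
Qed.

Lemma psd_entry_ge0 (C : numClosedFieldType) d (A : 'M[C]_d) i :
  psd A -> 0 <= A i i.
Proof.
move=> [_ /(_ (delta_mx i 0))].
by rewrite trmx_delta map_delta_mx -rowE -colE !mxE.
Qed.

Lemma mxtrace_unitary_conj (C : numClosedFieldType) d (U A : 'M[C]_d) :
  U \is unitarymx -> \tr (U ^t* *m A *m U) = \tr A.
Proof.
by move=> Uu; rewrite mxtrace_mulC mulmxA (unitarymxP Uu) mul1mx.
Qed.

(** * Uniqueness of the positive semidefinite square root *)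

Lemma psd_mxtrace_eq0 (C : numClosedFieldType) d (A : 'M[C]_d) :
  psd A -> \tr A = 0 -> A = 0.
Proof.
move=> /psd_spectral[eA D0]; rewrite eA mxtrace_unitary_conj ?spectral_unitarymx //.
rewrite mxtrace_diag => /eqP; rewrite psumr_eq0 // => /allP z.
suff -> : diag_mx (spectral_diag A) = 0 by rewrite mulmx0 mul0mx.
apply/matrixP => i j; rewrite !mxE; have /eqP -> := z i (mem_index_enum i).
by rewrite mul0rn.
Qed.

(* With Q = S - T, the psd matrices QSQ and QTQ have traces adding up to
   tr((ST - TS)Q) = 0, hence both vanish, and so does Q^3 = QSQ - QTQ. *)
Lemma psd_sqr_inj (C : numClosedFieldType) d (S T : 'M[C]_d) :
  psd S -> psd T -> S *m S = T *m T -> S = T.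
Proof.
move=> pS pT eST; have [Q eQ] : {Q | Q = S - T} by exists (S - T).
have hQ : Q ^t* = Q.
  by case: pS pT => /hermsymmxP hS _ [/hermsymmxP hT _]; rewrite eQ adjmxB hS hT.
have pQ A : psd A -> psd (Q *m A *m Q) by move=> /(psd_conjmx Q); rewrite hQ.
have tr0 : \tr (Q *m S *m Q) + \tr (Q *m T *m Q) = 0.
  rewrite -mxtraceD -mulmxDl -mulmxDr.
  have -> : Q *m (S + T) = S *m T - T *m S.
    by rewrite eQ mulmxBl !mulmxDr eST opprD addrA addrAC [_ + S *m T]addrC addrK.
  rewrite eQ mulmxBl !mulmxBr !raddfB /=.
  (* By cyclicity tr(STS) = tr(TSS) and tr(TST) = tr(STT), so the four terms cancel. *)
  rewrite -(mulmxA S T S) (mxtrace_mulC S) -(mulmxA T S T) (mxtrace_mulC T).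
  by rewrite -opprD subrr.
have zero (A B : 'M[C]_d) : psd A -> psd B -> \tr A + \tr B = 0 -> A = 0.
  move=> pA pB /eqP; rewrite paddr_eq0 ?sumr_ge0 // => [/andP[/eqP + _]||];
    by [exact: psd_mxtrace_eq0 | move=> *; exact: psd_entry_ge0].
have QS0 := zero _ _ (pQ _ pS) (pQ _ pT) tr0.
have QT0 : Q *m T *m Q = 0.
  by rewrite addrC in tr0; exact: zero _ _ (pQ _ pT) (pQ _ pS) tr0.
have Q3 : Q *m Q *m Q = 0.
  by rewrite [X in _ *m X *m _]eQ mulmxBr mulmxBl QS0 QT0 subr0.
have sq0 (B : 'M[C]_d) : B ^t* *m B = 0 -> B = 0.
  move=> /matrixP B0; apply/matrixP => k i; rewrite mxE.
  have /eqP := B0 i i; rewrite !mxE psumr_eq0 => [/allP z|j _].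
    by have := z k (mem_index_enum k); rewrite !mxE mulrC mul_conjC_eq0 => /eqP.
  by rewrite !mxE mulrC mul_conjC_ge0.
(* Since [Q] is Hermitian, Q^4 = 0 is the Gram matrix of Q^2, and Q^2 is that of [Q]; [sq0] applied
   twice brings the power down to 1. *)
have : Q *m Q = 0 by apply: sq0; rewrite adjmxM hQ mulmxA Q3 mul0mx.
by rewrite -{1}hQ => /sq0 /eqP; rewrite eQ subr_eq0 => /eqP.
Qed.

(** * The absolute value of a matrix *)

Lemma psd_gram (C : numClosedFieldType) d (X : 'M[C]_d) : psd (X ^t* *m X).
Proof.
rewrite -(mulmx1 (X ^t*)); apply: psd_conjmx.
rewrite -diag_const_mx; apply: psd_diag_mx => i; rewrite mxE; exact: ler01.
Qed.

Definition absmx (C : numClosedFieldType) d (X : 'M[C]_d) : 'M[C]_d :=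
  mxsqrt (X ^t* *m X).

(** Uniqueness of the psd root frees |X| from the eigenbasis of X^* X that [mxsqrt] picks, so that
    it can be computed in an eigenbasis of [X] itself. *)
Lemma absmx_unique (C : numClosedFieldType) d (X T : 'M[C]_d) :
  psd T -> T *m T = X ^t* *m X -> absmx X = T.
Proof.
move=> pT eT; apply: psd_sqr_inj => //; first exact/mxsqrt_psd/psd_gram.
by rewrite eT; apply/mxsqrt_sqr/psd_gram.
Qed.

Lemma hermsymmx_spectral (C : numClosedFieldType) d (X : 'M[C]_d) :
  X \is hermsymmx ->
  X = (spectralmx X) ^t* *m diag_mx (spectral_diag X) *m spectralmx X
  /\ forall i, spectral_diag X 0 i \is Num.real.
Proof.
move=> hX; split; last first.
  by move=> i; exact: (mxOverP (hermitian_spectral_diag_real hX)).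
rewrite -(invmx_unitary (spectral_unitarymx X)).
exact/orthomx_spectralP/hermitian_normalmx.
Qed.

Lemma unitary_diag_mul (C : numClosedFieldType) d (U : 'M[C]_d) (u v : 'rV_d) :
  U \is unitarymx ->
  (U ^t* *m diag_mx u *m U) *m (U ^t* *m diag_mx v *m U) =
  U ^t* *m diag_mx (\row_i (u 0 i * v 0 i)) *m U.
Proof.
by move=> Uu; rewrite !mulmxA (mulmxtVK _ Uu) -(mulmxA (U ^t*)) mulmx_diag.
Qed.

Lemma absmx_spectral (C : numClosedFieldType) d (X : 'M[C]_d) :
  X \is hermsymmx ->
  absmx X = (spectralmx X) ^t*
    *m diag_mx (map_mx Num.norm (spectral_diag X)) *m spectralmx X.
Proof.
move=> hX; have [eX rD] := hermsymmx_spectral hX.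
apply: absmx_unique.
  by apply/psd_conjmx/psd_diag_mx => i; rewrite mxE.
move/hermsymmxP: hX => ->; rewrite [in RHS]eX.
rewrite !unitary_diag_mul ?spectral_unitarymx //; congr (_ *m diag_mx _ *m _).
by apply/rowP => i; rewrite !mxE -!expr2 real_normK.
Qed.

Lemma mxtrace_absmx (C : numClosedFieldType) d (X : 'M[C]_d) :
  X \is hermsymmx -> \tr (absmx X) = \sum_i `|spectral_diag X 0 i|.
Proof.
move=> hX; rewrite absmx_spectral // mxtrace_unitary_conj ?spectral_unitarymx //.
by rewrite mxtrace_diag; apply: eq_bigr => i _; rewrite mxE.
Qed.

(** * The trace norm as a minimum over psd decompositions *)

Lemma jordan_decomposition (C : numClosedFieldType) d (X : 'M[C]_d) :
  X \is hermsymmx ->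
  exists P N, [/\ psd P, psd N, P - N = X & P + N = absmx X].
Proof.
move=> hX; have [eX rD] := hermsymmx_spectral hX; rewrite absmx_spectral //.
set U := spectralmx X in eX *; set D := spectral_diag X in eX rD *.
pose E u := U ^t* *m diag_mx u *m U.
(* In the eigenbasis these are max(lambda_i, 0) and max(-lambda_i, 0). *)
exists (E (\row_i ((`|D 0 i| + D 0 i) / 2))),
  (E (\row_i ((`|D 0 i| - D 0 i) / 2))).
split.
- apply/psd_conjmx/psd_diag_mx => i; rewrite mxE mulr_ge0 ?invr_ge0 ?ler0n //.
  by rewrite -[X in _ + X]opprK subr_ge0 -normrN real_ler_norm ?realN.
- apply/psd_conjmx/psd_diag_mx => i; rewrite mxE mulr_ge0 ?invr_ge0 ?ler0n //.
  by rewrite subr_ge0 real_ler_norm.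
- rewrite [RHS]eX /E -mulmxBl -mulmxBr -linearB /=; congr (_ *m diag_mx _ *m _).
  by apply/rowP => i; rewrite !mxE; field.
- rewrite /E -mulmxDl -mulmxDr -linearD /=; congr (_ *m diag_mx _ *m _).
  by apply/rowP => i; rewrite !mxE; field.
Qed.

Lemma mxtrace_absmx_le (C : numClosedFieldType) d (P N : 'M[C]_d) :
  psd P -> psd N -> \tr (absmx (P - N)) <= \tr (P + N).
Proof.
move=> pP pN; set X := P - N.
have hX : X \is hermsymmx by case: pP pN => hP _ [hN _]; exact: hermsymmxB.
rewrite mxtrace_absmx //; have [eX _] := hermsymmx_spectral hX.
set U := spectralmx X in eX *; set D := spectral_diag X in eX *.
have Uu : U ^t* \is unitarymx by rewrite trmxC_unitary spectral_unitarymx.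
(* [F] passes to the eigenbasis of [X], keeping traces and positivity; there the diagonals of [P]
   and [N] can be compared with the eigenvalues. *)
pose F (A : 'M[C]_d) := (U ^t*) ^t* *m A *m U ^t*.
have eD : diag_mx D = F P - F N.
  rewrite /F -mulmxBl -mulmxBr -/X eX !mulmxA trmxCK.
  rewrite (unitarymxP (spectral_unitarymx X)) mul1mx.
  by rewrite mulmxtVK ?spectral_unitarymx.
rewrite -(mxtrace_unitary_conj _ Uu) mulmxDr mulmxDl ler_sum // => i _.
have -> : D 0 i = F P i i - F N i i.
  by move/matrixP/(_ i i): eD; rewrite mxE eqxx mulr1n => ->; rewrite !mxE.
rewrite [leRHS]mxE (le_trans (ler_normB _ _)) // !ger0_norm //;
  exact/psd_entry_ge0/psd_conjmx.
Qed.

(** Adding the Jordan parts of [X] to those of [Y] gives a psd decomposition of [X + Y] whose total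
    trace is the right-hand side. *)
Lemma mxtrace_absmxD (C : numClosedFieldType) d (X Y : 'M[C]_d) :
  X \is hermsymmx -> Y \is hermsymmx ->
  \tr (absmx (X + Y)) <= \tr (absmx X) + \tr (absmx Y).
Proof.
move=> /jordan_decomposition[P [N [pP pN <- <-]]].
move=> /jordan_decomposition[P' [N' [pP' pN' <- <-]]].
rewrite -mxtraceD addrACA -opprD addrACA.
exact: mxtrace_absmx_le (psdD _ _) (psdD _ _).
Qed.

Lemma mxtrace_absmx_diag (C : numClosedFieldType) d (u : 'rV[C]_d) :
  (forall i, u 0 i \is Num.real) ->
  \tr (absmx (diag_mx u)) = \sum_i `|u 0 i|.
Proof.
move=> ru; rewrite (@absmx_unique _ _ _ (diag_mx (map_mx Num.norm u))).
- by rewrite mxtrace_diag; apply: eq_bigr => i _; rewrite mxE.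
- by apply: psd_diag_mx => i; rewrite mxE.
- move/hermsymmxP: (hermsymmx_diag ru) => ->; rewrite !mulmx_diag; congr diag_mx.
  by apply/rowP => i; rewrite !mxE -!expr2 real_normK.
Qed.

(** * Incoherent states as a compact simplex *)

Section Incoherent.
Variables (R : realType) (d : nat).

Definition diagC (p : 'rV[R]_d) : 'M[R[i]]_d :=
  diag_mx (map_mx (real_complex R) p).

Definition simplex : set 'rV[R]_d :=
  [set p | (forall i, 0 <= p 0 i) /\ \sum_i p 0 i = 1].

Lemma normc_real (x : R) : `|real_complex R x| = real_complex R `|x|.
Proof. by rewrite normc_def /= expr0n addr0 sqrtr_sqr. Qed.

Lemma ReD (x y : R[i]) : complex.Re (x + y) = complex.Re x + complex.Re y.
Proof. by case: x y => [? ?] [? ?]. Qed.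

Lemma ler_Re (x y : R[i]) : x <= y -> complex.Re x <= complex.Re y.
Proof. by rewrite lecE => /andP[]. Qed.

Lemma incoherent_diagC (p : 'rV[R]_d) : simplex p -> is_incoherent (diagC p).
Proof.
move=> [p0 p1]; split; last exact: diag_mx_is_diag.
split; first by apply: psd_diag_mx => i; rewrite mxE ler0c.
rewrite mxtrace_diag; under eq_bigr do rewrite mxE.
by rewrite -rmorph_sum /= p1.
Qed.

Lemma incoherentP (A : 'M[R[i]]_d) :
  is_incoherent A -> exists2 p, simplex p & A = diagC p.
Proof.
(* Diagonal entries of a psd matrix are nonnegative, hence real, so [Re] loses nothing. *)
move=> [[pA trA] dA]; exists (\row_i complex.Re (A i i)).
  split=> [i|]; first by rewrite mxE; exact: (ler_Re (psd_entry_ge0 i pA)).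
  under eq_bigr do rewrite mxE; apply: complexI; rewrite rmorph_sum /=.
  rewrite -[RHS]trA; apply: eq_bigr => i _.
  by rewrite RRe_real // ger0_real // psd_entry_ge0.
apply/matrixP => i j; rewrite !mxE; case: eqVneq => [<-|ij].
  by rewrite mulr1n RRe_real // ger0_real // psd_entry_ge0.
by rewrite mulr0n (is_diag_mxP dA).
Qed.

(** The simplex is the unit cube cut by a closed hyperplane; nonnegative coordinates with sum 1 are
    each at most 1. *)
Lemma simplex_compact : compact simplex.
Proof.
have -> : simplex = [set v : 'rV[R]_d | forall i, `[0, 1]%classic (v ord0 i)]
    `&` (fun v : 'rV[R]_d => \sum_i v 0 i) @^-1` [set x | x = 1].
  apply/seteqP; split=> [p [p0 p1]|p [p01 p1]]; split=> // i.
    by rewrite /= in_itv /= p0 -p1 (bigD1 i) //= lerDl sumr_ge0.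
  by have := p01 i; rewrite /= in_itv => /andP[].
apply: compact_closedI; first exact: (rV_compact (fun=> @segment_compact R 0 1)).
apply: preimage_closed; last exact: closed_eq.
move=> v _; apply: (cvg_big (@add_continuous R) (nbhs_filter v)) => i _.
exact: coord_continuous.
Qed.

Lemma simplex_nonempty : (0 < d)%N -> simplex !=set0.
Proof.
move=> d0; exists (delta_mx 0 (Ordinal d0)); split=> [i|].
  by rewrite mxE ler0n.
rewrite (bigD1 (Ordinal d0)) //= mxE !eqxx big1 ?addr0 // => i /negPf ni.
by rewrite mxE ni.
Qed.

(** * Continuity of the distance and attainment of its minimum *)

Variable rho : 'M[R[i]]_d.
Hypothesis hrho : rho \is hermsymmx.

Lemma hermsymmx_diagC p : diagC p \is hermsymmx.
Proof.
by apply: hermsymmx_diag => i; rewrite mxE; apply/complex_realP; eexists.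
Qed.

(** Triangle inequality for the summands [rho - diagC q] and [diagC (q - p)]; the second is
    diagonal, so its trace norm is the l1 norm. *)
Lemma trace_norm_lipschitz p q :
  trace_norm (rho - diagC p) <=
  trace_norm (rho - diagC q) + \sum_i `|q 0 i - p 0 i|.
Proof.
have hq := hermsymmxB hrho (hermsymmx_diagC q).
have := mxtrace_absmxD hq (hermsymmx_diagC (q - p)).
have -> : rho - diagC q + diagC (q - p) = rho - diagC p.
  by rewrite /diagC map_mxB linearB /= addrA subrK.
move=> /ler_Re; rewrite ReD => /le_trans -> //.
rewrite lerD2l /diagC mxtrace_absmx_diag.
  by under eq_bigr do rewrite !mxE normc_real; rewrite -rmorph_sum.
by move=> i; rewrite mxE; apply/complex_realP; eexists.
Qed.

Lemma trace_norm_diagC_continuous :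
  continuous (fun p => trace_norm (rho - diagC p)).
Proof.
move=> p; apply/(@cvgrPdist_lt _ _ _ _ (nbhs_filter p)) => e e0.
have : {for p, continuous (fun q : 'rV[R]_d => \sum_i `|p 0 i - q 0 i|)}.
  apply: (cvg_big (@add_continuous R) (nbhs_filter p)) => i _.
  apply: (cvg_comp (fun q : 'rV_d => q 0 i) (fun x => `|p 0 i - x|)).
    exact: coord_continuous.
  by apply: cvg_norm; apply: cvgB; [exact: cvg_cst | exact: cvg_id].
move=> /(@cvgrPdist_lt _ _ _ _ (nbhs_filter p) _ _)/(_ e e0).
have z : \sum_i `|p 0 i - p 0 i| = 0.
  by rewrite big1 // => i _; rewrite subrr normr0.
apply: filterS => q; rewrite z sub0r normrN ger0_norm ?sumr_ge0 // => pq.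
(* The two-sided bound is the Lipschitz estimate used twice, with [p] and [q] exchanged. *)
apply: le_lt_trans pq; rewrite ler_norml lerNl opprB !lerBlDl.
rewrite trace_norm_lipschitz; under eq_bigr do rewrite distrC.
exact: trace_norm_lipschitz.
Qed.

Lemma incoherent_distances_min :
  (0 < d)%N -> exists m, is_minimum (incoherent_distances rho) m.
Proof.
move=> d0; have [|p /set_mem sp pmin] :=
  compact_EVT_min (f := fun p => trace_norm (rho - diagC p))
    (simplex_nonempty d0) simplex_compact.
  by apply: continuous_subspaceT => x; exact: trace_norm_diagC_continuous.
exists (trace_norm (rho - diagC p)); split.
  by exists (diagC p) => //; exact: incoherent_diagC.
by move=> _ [A /incoherentP[q sq ->] <-]; apply: pmin; rewrite inE.
Qed.

End Incoherent.

(** The empty matrix has trace 0, not 1. Positive dimension makes the simplex nonempty. *)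
Lemma state_dim_gt0 (C : numClosedFieldType) d (A : 'M[C]_d) :
  is_state A -> (0 < d)%N.
Proof.
by case: d A => [|//] A [_ /eqP]; rewrite /mxtrace big_ord0 eq_sym oner_eq0.
Qed.

(** * Equality of the coherence and the program value *)

Theorem mainTheorem4 (R : realType) (d : nat) (rho : 'M[R[i]]_d)
    (rho_state : is_state rho) :
  is_minimum (incoherent_distances rho) (trace_coherence rho) /\
  sdp_value rho = (trace_coherence rho)%:E.
Proof.
have hrho : rho \is hermsymmx by case: rho_state => [[]].
have mintr : is_minimum (incoherent_distances rho) (trace_coherence rho).
  (* A minimum exists, so [xget] returns it and not its default 0. *)
  exact: xgetPex (incoherent_distances_min hrho (state_dim_gt0 rho_state)).
split=> //; case: mintr => -[delta idelta eqtr] lbtr.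
apply/eqP; rewrite eq_le; apply/andP; split.
(* A closest incoherent [delta] with the Jordan parts of [rho - delta] is feasible and has the
   coherence as its objective value. *)
- have hdelta : delta \is hermsymmx by case: idelta => [[[]]].
  have [P [N [pP pN eX eA]]] := jordan_decomposition (hermsymmxB hrho hdelta).
  apply: ereal_inf_lbound; exists P, N, delta; split; last by rewrite eA -eqtr.
  by case: idelta => [[? ?] ?]; split.
(* Conversely, the [A] of any feasible point is incoherent, and tr(P + N) bounds the trace norm of
   [rho - A] from above. *)
- apply: le_ereal_inf_tmp => _ [P [N [A [[eX trA dA pP pN pA] ->]]]].
  rewrite lee_fin (@le_trans _ _ (trace_norm (rho - A))) //.
    by apply: lbtr; exists A.
  by rewrite -eX; exact/ler_Re/mxtrace_absmx_le.
Qed.
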